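(* Let $G$ be a group and $U\subseteq G$ a subset such that for every $k\in\mathbb{N}$ there are $a_0,\dots,a_{k-1}\in G$ such that for every $i\neq j$ the set $a_iU\cap a_jU^c$ is right syndetic. Let $\mathcal{A}$ be any $G$-algebra of subsets of $G$ which contains $U$. Then the ambit $(G,S(\mathcal{A}),p_e)$ does not have sep. fin. DRdeg.
   Context: $U^c=G\setminus U$. A subset of $G$ is right syndetic if finitely many of its right translates cover $G$. A $G$-algebra of subsets of $G$ is a Boolean algebra of subsets of $G$ closed under left translations by elements of $G$. $S(\mathcal{A})$ is its Stone space of ultrafilters, on which the (discrete) group $G$ acts by left translations: $gp=\{gA:A\in p\}$; $p_e=\{A\in\mathcal{A}:e\in A\}$ has dense orbit, so $(G,S(\mathcal{A}),p_e)$ is a $0$-dimensional ambit (compact Hausdorff $0$-dimensional $G$-space with a distinguished point with dense orbit). For a $0$-dimensional ambit $(G,X,x_0)$ with algebra of clopen sets $\mathcal{B}$: a coloring is a function $c\colon G\to 2^n$, $n\ge 1$. For $\Sigma\subseteq\mathcal{B}$, $c$ is a definable $\Sigma$-coloring if there are $U_0,\dots,U_{n-1}\in\Sigma$ and $y_0,\dots,y_{n-1}\in Gx_0$ such that for all $g\in G$, $i<n$: $c(g)(i)=1$ if $y_i\in gU_i$ and $c(g)(i)=0$ if $y_i\notin gU_i$. The ambit has separately finite definable Ramsey degree (sep. fin. DRdeg) if for every finite $\Sigma\subseteq\mathcal{B}$ there is $l\ge 1$ such that for every definable $\Sigma$-coloring $c\colon G\to 2^n$ (any $n\geq 1$), every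 $k\ge 1$ and every $k$-element $A\subseteq G$, there is $h\in G$ with $|c[hA]|\le l$. *)

(* Defs.v *)
From HB Require Import structures.
From mathcomp Require Import all_boot all_fingroup.
From mathcomp Require Import all_classical.
From mathcomp Require Import topology.

Set Implicit Arguments.
Unset Strict Implicit.
Unset Printing Implicit Defensive.

Local Open Scope classical_set_scope.

Definition ltranslate (G : groupType) (g : G) (A : set G) : set G :=
  [set (g * x)%g | x in A].

Definition rtranslate (G : groupType) (A : set G) (g : G) : set G :=
  [set (x * g)%g | x in A].

Definition right_syndetic (G : groupType) (A : set G) : Prop :=
  exists F : set G, finite_set F /\ \bigcup_(g in F) rtranslate A g = setT.

Record galgebra (G : groupType) := GAlgebra {
  gsets : set (set G);
  gsetsT : gsets setT;
  gsetsC : forall A, gsets A -> gsets (~` A);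
  gsetsI : forall A B, gsets A -> gsets B -> gsets (A `&` B);
  gsetsM : forall g A, gsets A -> gsets (ltranslate g A)
}.

Record zdambit (G : groupType) := ZDAmbit {
  space :> topologicalType;
  act : G -> space -> space;
  basepoint : space;
  act1 : forall x, act 1%g x = x;
  actM : forall g h x, act (g * h)%g x = act g (act h x);
  act_continuous : forall g, continuous (act g);
  space_compact : compact [set: space];
  space_hausdorff : hausdorff_space space;
  (* The clopen sets form a base. The library's [zero_dimensional] only asks
     that points be separated by clopen sets. *)
  space_zero_dim : basis (@clopen space);
  orbit_dense : dense (range (act ^~ basepoint))
}.

Arguments act {G X} : rename.
Arguments basepoint {G X} : rename.

Section Coloring.
Variables (G : groupType) (X : zdambit G).

(* 2 ^ n is rendered as {ffun 'I_n -> bool}. *)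
Definition definable_coloring (Sigma : set (set X)) (n : nat)
    (c : G -> {ffun 'I_n -> bool}) : Prop :=
  exists (U : 'I_n -> set X) (y : 'I_n -> X),
    [/\ forall i, Sigma (U i),
        forall i, range (act ^~ basepoint) (y i) &
        forall (g : G) (i : 'I_n),
          ((act g @` U i) (y i) -> c g i = true) /\
          (~ (act g @` U i) (y i) -> c g i = false)].

Definition sep_fin_DRdeg : Prop :=
  forall Sigma : set (set X), finite_set Sigma -> Sigma `<=` clopen ->
  exists l : nat, (1 <= l)%N /\
  forall (n : nat) (c : G -> {ffun 'I_n -> bool}),
    (1 <= n)%N -> definable_coloring Sigma c ->
  forall (k : nat) (A : set G), (1 <= k)%N -> (A #= `I_k)%card ->
  exists h : G, (c @` ltranslate h A #<= `I_l)%card.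

End Coloring.

Section Translates.
Variable G : groupType.
Implicit Types (g h : G) (A B : set G).

Lemma ltranslateE g A : ltranslate g A = [set x | A (g^-1 * x)%g].
Proof.
apply/seteqP; split => [_ [x Ax <-]|x /= Ax] /=; first by rewrite mulKg.
by exists (g^-1 * x)%g => //; rewrite mulVKg.
Qed.

Lemma ltranslate1 A : ltranslate 1%g A = A.
Proof. by rewrite ltranslateE; apply/seteqP; split=> x /=; rewrite invg1 mul1g. Qed.

Lemma ltranslateM g h A : ltranslate (g * h)%g A = ltranslate g (ltranslate h A).
Proof.
by rewrite !ltranslateE; apply/seteqP; split=> x /=; rewrite invMg mulgA.
Qed.

Lemma ltranslateK g : cancel (@ltranslate G g) (ltranslate g^-1%g).
Proof. by move=> A; rewrite -ltranslateM mulVg ltranslate1. Qed.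

Lemma ltranslateVK g : cancel (@ltranslate G g^-1%g) (ltranslate g).
Proof. by move=> A; rewrite -ltranslateM mulgV ltranslate1. Qed.

Lemma ltranslateT g : ltranslate g setT = setT.
Proof. by rewrite ltranslateE. Qed.

Lemma ltranslate0 g : ltranslate g set0 = set0.
Proof. exact: image_set0. Qed.

Lemma ltranslateI g A B :
  ltranslate g (A `&` B) = ltranslate g A `&` ltranslate g B.
Proof. by rewrite !ltranslateE. Qed.

Lemma ltranslateC g A : ltranslate g (~` A) = ~` ltranslate g A.
Proof. by rewrite !ltranslateE. Qed.

Lemma ltranslateS g A B : A `<=` B -> ltranslate g A `<=` ltranslate g B.
Proof. exact: image_subset. Qed.

End Translates.

Record ultrafilter_on (G : groupType) (A : galgebra G) (p : set (set G)) :
    Prop := UltrafilterOn {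
  uf_sub : p `<=` gsets A;
  ufT : p setT;
  uf0 : ~ p set0;
  ufI : forall B C, p B -> p C -> p (B `&` C);
  ufS : forall B C, p B -> gsets A C -> B `<=` C -> p C;
  ufC : forall B, gsets A B -> p B \/ p (~` B)
}.

Record stone (G : groupType) (A : galgebra G) := Stone {
  stone_set : set (set G);
  stoneP : ultrafilter_on A stone_set
}.

HB.instance Definition _ (G : groupType) (A : galgebra G) :=
  gen_eqMixin (stone A).
HB.instance Definition _ (G : groupType) (A : galgebra G) :=
  gen_choiceMixin (stone A).

Section StoneSpace.
Variables (G : groupType) (A : galgebra G).
Implicit Types (p q : stone A) (B C : set G).

Lemma stone_ext p q : stone_set p = stone_set q -> p = q.
Proof.
case: p q => [p pP] [q qP] /= pq; rewrite -pq in qP *.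
by rewrite (Prop_irrelevance pP qP).
Qed.

Definition stone_base (B : set G) : set (stone A) := [set p | stone_set p B].

Lemma stone_base_cover : \bigcup_(B in gsets A) stone_base B = setT.
Proof.
apply/seteqP; split => // p _; exists setT; first exact: gsetsT.
exact: ufT (stoneP p).
Qed.

Lemma stone_base_join B C p : gsets A B -> gsets A C ->
  stone_base B p -> stone_base C p ->
  exists D, [/\ gsets A D, stone_base D p &
    stone_base D `<=` stone_base B `&` stone_base C].
Proof.
move=> AB AC pB pC; exists (B `&` C); split.
- exact: gsetsI.
- exact: ufI (stoneP p) _ _ pB pC.
- move=> q qBC; have qP := stoneP q.
  by split; apply: (ufS qP qBC) => // x [].
Qed.

HB.instance Definition _ :=
  isBaseTopological.Build (stone A) stone_base_cover stone_base_join.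

Lemma open_stone_base B : gsets A B -> open (stone_base B).
Proof.
move=> AB; exists [set B]; first by move=> _ ->.
by rewrite bigcup_set1.
Qed.

Lemma nbhs_stone_base B p : gsets A B -> stone_set p B -> nbhs p (stone_base B).
Proof. by move=> AB pB; apply: open_nbhs_nbhs; split; [exact: open_stone_base|]. Qed.

Lemma open_stoneP (O : set (stone A)) p : open O -> O p ->
  exists B, [/\ gsets A B, stone_base B p & stone_base B `<=` O].
Proof.
move=> [D DA <-] [B DB pB]; exists B; split => //; first exact: DA.
by move=> q qB; exists B.
Qed.

Lemma stone_baseC B : gsets A B -> stone_base (~` B) = ~` stone_base B.
Proof.
move=> AB; apply/seteqP; split => p.
  by move=> pC pB; apply: (uf0 (stoneP p)); rewrite -(setICr B); apply: (ufI (stoneP p)).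
by move=> npB; case: (ufC (stoneP p) AB).
Qed.

Lemma clopen_stone_base B : gsets A B -> clopen (stone_base B).
Proof.
move=> AB; split; first exact: open_stone_base.
rewrite -[stone_base B]setCK -stone_baseC//; apply: open_closedC.
exact/open_stone_base/gsetsC.
Qed.

Lemma stone_zero_dim : basis (@clopen (stone A)).
Proof.
split; first by move=> O [].
move=> p O; rewrite nbhsE => -[V [oV Vp] VO].
have [B [AB pB BV]] := open_stoneP oV Vp.
exists (stone_base B); last exact: subset_trans VO.
by split => //; exact: clopen_stone_base.
Qed.

Lemma stone_hausdorff : hausdorff_space (stone A).
Proof.
move=> p q pq; apply: stone_ext.
have H B : gsets A B -> stone_set p B -> stone_set q B.
  move=> AB pB; case: (ufC (stoneP q) AB) => // qB.
  have [||r [rB rC]] := pq (stone_base B) (stone_base (~` B)).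
  - exact: nbhs_stone_base.
  - exact: nbhs_stone_base (gsetsC AB) qB.
  by move: rC; rewrite stone_baseC.
apply/seteqP; split => B.
  by move=> pB; apply: H => //; exact: (uf_sub (stoneP p)).
move=> qB; have AB := uf_sub (stoneP q) qB.
case: (ufC (stoneP p) AB) => // pB.
have qC := H _ (gsetsC AB) pB.
by case: (uf0 (stoneP q)); rewrite -(setICr B); exact: (ufI (stoneP q)).
Qed.

Lemma stone_compact : compact [set: stone A].
Proof.
rewrite compact_ultra => F FU _.
have FP : ProperFilter F := ultra_proper.
pose p := [set B | gsets A B /\ F (stone_base B)].
have pP : ultrafilter_on A p.
  split.
  - by move=> B [].
  - split; first exact: gsetsT.
    by apply: filterS filterT => q _; exact: (ufT (stoneP q)).
  - move=> [_ F0]; have [q] := filter_ex F0; exact: (uf0 (stoneP q)).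
  - move=> B C [AB FB] [AC FC]; split; first exact: gsetsI.
    by apply: filterS2 FB FC => q; exact: (ufI (stoneP q)).
  - move=> B C [AB FB] AC BC; split => //.
    by apply: filterS FB => q qB; exact: (ufS (stoneP q)) qB AC BC.
  - move=> B AB; case: (in_ultra_setVsetC (stone_base B) FU) => FB.
      by left.
    by right; split; [exact: gsetsC|rewrite stone_baseC].
exists (Stone pP); split => // O; rewrite nbhsE => -[V [oV Vp] VO].
have [B [AB [_ FB] BV]] := open_stoneP oV Vp.
by apply: filterS FB; exact: subset_trans VO.
Qed.

Definition stone_act_set (g : G) (p : set (set G)) : set (set G) :=
  [set ltranslate g B | B in p].

Lemma stone_act_setE g (p : set (set G)) :
  stone_act_set g p = [set B | p (ltranslate g^-1%g B)].
Proof.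
apply/seteqP; split => [_ [B pB <-]|B pB] /=; first by rewrite ltranslateK.
by exists (ltranslate g^-1%g B) => //; rewrite ltranslateVK.
Qed.

Lemma stone_act_subproof g p : ultrafilter_on A (stone_act_set g (stone_set p)).
Proof.
have pP := stoneP p; split.
- by move=> _ [B pB <-]; apply: gsetsM; exact: (uf_sub pP).
- by rewrite stone_act_setE /= ltranslateT; exact: (ufT pP).
- by rewrite stone_act_setE /= ltranslate0; exact: (uf0 pP).
- move=> B C; rewrite stone_act_setE /= ltranslateI; exact: (ufI pP).
- move=> B C; rewrite stone_act_setE /= => pB AC BC.
  by apply: (ufS pP pB); [exact: gsetsM|exact: ltranslateS].
- move=> B AB; rewrite stone_act_setE /= ltranslateC.
  by apply: (ufC pP); exact: gsetsM.
Qed.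

Definition stone_act (g : G) (p : stone A) : stone A :=
  Stone (stone_act_subproof g p).

Lemma principal_subproof : ultrafilter_on A [set B | gsets A B /\ B 1%g].
Proof.
split.
- by move=> B [].
- by split => //; exact: gsetsT.
- by case.
- by move=> B C [AB B1] [AC C1]; split; [exact: gsetsI|split].
- by move=> B C [AB B1] AC BC; split => //; exact: BC.
- move=> B AB; have [B1|nB1] := pselect (B 1%g); first by left.
  by right; split => //; exact: gsetsC.
Qed.

Definition principal_e : stone A := Stone principal_subproof.

Lemma stone_act1 p : stone_act 1%g p = p.
Proof.
apply: stone_ext; rewrite /= stone_act_setE; apply/seteqP.
by split=> B /=; rewrite invg1 ltranslate1.
Qed.

Lemma stone_actM g h p : stone_act (g * h)%g p = stone_act g (stone_act h p).
Proof.
apply: stone_ext; rewrite /= !stone_act_setE; apply/seteqP.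
by split=> B /=; rewrite invMg ltranslateM.
Qed.

Lemma stone_act_continuous g : continuous (stone_act g).
Proof.
move=> p O; rewrite nbhsE => -[V [oV Vp] VO].
have [B [AB + BV]] := open_stoneP oV Vp.
rewrite /stone_base /= stone_act_setE /= => pB.
apply: (@filterS _ (nbhs p) _ (stone_base (ltranslate g^-1%g B))).
  by move=> q qB; apply/VO/BV; rewrite /stone_base /= stone_act_setE.
by apply: nbhs_stone_base => //; exact: gsetsM.
Qed.

Lemma stone_orbit_dense : dense (range (stone_act ^~ principal_e)).
Proof.
move=> O [p Op] oO; have [B [AB pB BO]] := open_stoneP oO Op.
have [x Bx] : B !=set0.
  by apply/set0P/eqP => B0; apply: (uf0 (stoneP p)); rewrite -B0.
exists (stone_act x principal_e); split; last by exists x.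
apply: BO; rewrite /stone_base /= stone_act_setE /=; split; first exact: gsetsM.
by rewrite ltranslateE /= invgK mulg1.
Qed.

Definition stone_ambit : zdambit G :=
  ZDAmbit stone_act1 stone_actM stone_act_continuous stone_compact
    stone_hausdorff stone_zero_dim stone_orbit_dense.

End StoneSpace.

(* Main.v *)
Require Import Defs.
From mathcomp Require Import all_boot all_fingroup.
From mathcomp Require Import all_classical.
From mathcomp Require Import topology.

(** The one-element family consisting of the clopen set of ultrafilters
    containing [U] already refutes separately finite definable Ramsey degree.
    At the orbit point [t p_e], the coloring it defines reads off whether
    [t \in gU] ([act_stone_base_principal]).  Given a bound [l], take
    [a_0, ..., a_l] as in the hypothesis.  Two elements [h a_i] and [h a_j]
    receive different colors as soon as some test point [t] satisfies
    [h^-1 t \in a_i U `&` a_j U^c].  Since the latter set is right syndetic, a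
    finite set of test points [t] serves for all [h] at once, and finitely many
    pairs [(i, j)] still require only finitely many test points
    ([syndetic_family_test_points]).  The coloring built from these points is
    therefore injective on each translate [h {a_0, ..., a_l}], so it takes
    [l + 1] colors there. *)

Set Implicit Arguments.
Unset Strict Implicit.
Unset Printing Implicit Defensive.

Local Open Scope classical_set_scope.

(** If [S F] is the whole group, write [h] as [x f] with [x \in S] and
    [f \in F]; then [h f^-1] lies in [S], so [F^-1] is a set of test points. *)
Lemma syndetic_test_points (G : groupType) (S : set G) :
  right_syndetic S ->
  exists s : seq G, forall h, exists2 t, t \in s & S (h * t)%g.
Proof.
move=> [F [/finite_seqP[s ->] SF]].
exists [seq f^-1%g | f <- s] => h.
have : setT h by [].
rewrite -SF => -[f /= fs [x Sx <-]].
by exists f^-1%g; [exact: map_f|rewrite mulgK].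
Qed.

Lemma syndetic_family_test_points (G : groupType) (I : finType) (P : pred I)
    (S : I -> set G) :
  (forall i, P i -> right_syndetic (S i)) ->
  exists s : seq G, forall i h, P i -> exists2 t, t \in s & S i (h * t)%g.
Proof.
move=> synS.
have /choice[s sP] (i : I) : exists s : seq G,
    P i -> forall h, exists2 t, t \in s & S i (h * t)%g.
  case: (boolP (P i)) => [/synS/syndetic_test_points[s sP]|_]; first by exists s.
  by exists [::].
exists (flatten [seq s i | i <- enum I]) => i h Pi.
have [t ts St] := sP i Pi h; exists t => //.
by apply/flatten_mapP; exists i; rewrite ?mem_enum.
Qed.

Lemma act_stone_base_principal (G : groupType) (A : galgebra G) (B : set G)
    (g t : G) : gsets A B ->
  (stone_act g @` stone_base B) (stone_act t (principal_e A)) <->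
  B (g^-1 * t)%g.
Proof.
move=> AB.
have baseE u : stone_base B (stone_act u (principal_e A)) <-> B u.
  rewrite /stone_base /= stone_act_setE /=.
  have -> : ltranslate u^-1%g B 1%g = B u.
    by rewrite ltranslateE /= invgK mulg1.
  by split=> [[]//|Bu]; split=> //; exact: gsetsM.
split=> [[p Bp pt]|Bgt].
  by apply/baseE; rewrite stone_actM -pt -stone_actM mulVg stone_act1.
exists (stone_act (g^-1 * t)%g (principal_e A)); first exact/baseE.
by rewrite -stone_actM mulVKg.
Qed.

Theorem lemma3p33 (G : groupType) (U : set G)
    (hU : forall k : nat, exists a : 'I_k -> G, forall i j : 'I_k, i != j ->
      right_syndetic (ltranslate (a i) U `&` ltranslate (a j) (~` U)))
    (A : galgebra G) (AU : gsets A U) :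
  ~ sep_fin_DRdeg (stone_ambit A).
Proof.
move=> /(_ [set stone_base U] (finite_set1 _)) [].
  by move=> _ ->; exact: clopen_stone_base.
move=> l [_ bound].
have [a aP] := hU l.+1.
have [s sP] := @syndetic_family_test_points G ('I_l.+1 * 'I_l.+1)%type
  (fun ij => ij.1 != ij.2)
  (fun ij => ltranslate (a ij.1) U `&` ltranslate (a ij.2) (~` U))
  (fun ij => aP ij.1 ij.2).
(* The extra test point [1] ensures that colors have at least one coordinate. *)
pose T := 1%g :: s.
pose c (g : G) : {ffun 'I_(size T) -> bool} :=
  [ffun i : 'I_(size T) => `[< U (g^-1 * nth 1%g T i)%g >]].
have c_inj h i j : c (h * a i)%g = c (h * a j)%g -> i = j.
  move=> cij; apply/eqP/negPn/negP => neq_ij.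
  have [t ts] := sP (i, j) h^-1%g neq_ij.
  rewrite !ltranslateE /= => -[Ui nUj]; apply: nUj.
  have tT : (index t T < size T)%N by rewrite index_mem inE ts orbT.
  have /ffunP/(_ (Ordinal tT)) := cij.
  rewrite !ffunE /= nth_index ?inE ?ts ?orbT// !invMg -!mulgA => eqU.
  by apply/asboolP; rewrite -eqU; apply/asboolP.
have c_def : @definable_coloring G (stone_ambit A) [set stone_base U] _ c.
  exists (fun=> stone_base U).
  exists (fun i => stone_act (nth 1%g T i) (principal_e A)).
  split=> [//|i|g i]; first by exists (nth 1%g T i).
  rewrite ffunE; split=> [/(act_stone_base_principal _ _ AU) Ug|nUg].
    exact/asboolP.
  by apply/asboolP => Ug; apply/nUg/(act_stone_base_principal _ _ AU).
(* Reindexing by natural numbers turns both cardinality facts below into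
   injectivity on [`I_l.+1]. *)
pose b m := a (inord m).
have cb_inj h : {in `I_l.+1 &, injective (fun m => c (h * b m)%g)}.
  move=> m m' /set_mem/= ml /set_mem/= m'l /c_inj/(congr1 val) /=.
  by rewrite !inordK.
have b_inj : {in `I_l.+1 &, injective b}.
  by move=> m m' ml m'l bb; apply: (cb_inj 1%g) => //; rewrite bb.
have [h] := bound _ c isT c_def l.+1 (b @` `I_l.+1) isT (inj_card_eq b_inj).
rewrite /ltranslate !image_comp.
rewrite (card_le_eql (inj_card_eq (cb_inj h))).
by rewrite card_le_II ltnn.
Qed.
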